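(* Consider the networked control system $$\Theta(k+1)=\bar A(d(k))\,\Theta(k)+\bar B\,\omega(k),\qquad k\in\mathbb N_0,$$ with $\Theta(k)=\begin{bmatrix}x(k)\\ b(k-1)\end{bmatrix}\in\mathbb R^{p+N}$ and with $\bar A(0),\bar A(1),\bar B$ as defined in the context, where the packet dropouts $d(k)\in\{0,1\}$ are i.i.d. with $\Pr\{d(k)=1\}=p_d$, and $\omega(k)$ is zero-mean white Gaussian noise with variance $\sigma_\omega^2$. Suppose that this system is mean square stable, that $\sigma_\omega^2$ is finite, and that, in the absence of quantization effects, the first- and second-order moments of the plant state are $\mathbb E\{x(k)\}=0$ and $Q_x=\operatorname{var}\{x(k)\}=\mathbb E\{x(k)x(k)^T\}$. Then the matrix $$Q_\Theta=\lim_{k\to\infty}\mathbb E\{\Theta(k)\Theta(k)^T\}$$ can be computed as (i.e. satisfies) $$Q_\Theta=\mathcal A\,Q_\Theta\,\mathcal A^T+p_d(1-p_d)\,\tilde{\mathcal A}\,Q_\Theta\,\tilde{\mathcal A}^T+\sigma_\omega^2\,\bar B\bar B^T,$$ where $$\mathcal A=\mathbb E\{\bar A(d(k))\}=p_d\,\bar A(1)+(1-p_d)\,\bar A(0),\qquad \tilde{\mathcal A}=\bar A(1)-\bar A(0).$$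
   Context: Plant: $x(k+1)=Ax(k)+B_1u(k)+B_2\omega(k)$, $k\in\mathbb N_0$, with $x(k)\in\mathbb R^p$, $A\in\mathbb R^{p\times p}$, $B_1,B_2\in\mathbb R^p$, scalar input $u(k)$, and zero-mean white Gaussian disturbance $\omega(k)$ with variance $\sigma_\omega^2$. The pair $(A,B_1)$ is controllable (or at least stabilizable). $\omega(k)$ and $d(k)$ are independent of each other and, being white and i.i.d. respectively, independent of $\Theta(k)$. Controller (no quantization): at each time $k$ the controller transmits the vector $\vec u(k)=-Kx(k)\in\mathbb R^N$ of $N$ predicted inputs, where $N\ge 1$ is the horizon length. The feedback gain is $K=W^{-1}F^T\in\mathbb R^{N\times p}$, with $W=\bar R+\Phi^T\bar Q\Phi\in\mathbb R^{N\times N}$, $F=\Upsilon^T\bar Q\Phi\in\mathbb R^{p\times N}$, where $\Phi\in\mathbb R^{Np\times N}$ is the block lower-triangular matrix whose $(i,j)$ block ($p\times1$) is $A^{i-j}B_1$ for $i\ge j$ and $0$ otherwise, $\Upsilon=\begin{bmatrix}A^T&(A^2)^T&\cdots&(A^N)^T\end{bmatrix}^T\in\mathbb R^{Np\times p}$, $\bar Q=\operatorname{blockdiag}(Q,\dots,Q,X)\in\mathbb R^{Np\times Np}$, $\bar R=\operatorname{diag}\{R,\dots,R\}\in\mathbb R^{N\times N}$; $Q\succeq0$ ($p\times p$) and $R>0$ (scalar) are weights, and $X$ is the symmetric positive definite solution of the discrete algebraic Riccati equation $X=A^TXA+Q-A^TXB_1(R+B_1^TXB_1)^{-1}B_1^TXA$.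 Buffer: $d(k)=1$ if a packet dropout occurs at time $k$ and $d(k)=0$ otherwise. The buffer evolves as $b(k)=(1-d(k))\,\vec u(k)+d(k)\,M\,b(k-1)\in\mathbb R^N$, where $M$ is the $N\times N$ shift matrix with ones on the first superdiagonal and zeros elsewhere. The plant input is the first buffer entry, $u(k)=e_1^Tb(k)$, with $e_1=[1,0,\dots,0]^T\in\mathbb R^N$. The system matrices are $$\bar A(0)=\begin{bmatrix}A-B_1e_1^TK&0_{p\times N}\\-K&0_{N\times N}\end{bmatrix},\quad \bar A(1)=\begin{bmatrix}A&B_1e_1^TM\\0_{N\times p}&M\end{bmatrix},\quad \bar B=\begin{bmatrix}B_2\\0_N\end{bmatrix}.$$ Mean square stability: the system is mean square stable if there exist bounded $\mu$ and $Q_\Theta$ such that $\mathbb E\{\Theta(k)\}\to\mu$ and $\mathbb E\{\Theta(k)\Theta(k)^T\}\to Q_\Theta$ as $k\to\infty$, for all initial conditions $\Theta(0)$ with bounded variance and $d(0)\in\{0,1\}$. *)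

(* Defs.v *)
(* Library world: MathComp and MathComp-Analysis. *)
From mathcomp Require Import all_boot all_order all_algebra.
From mathcomp Require Import complex.
From mathcomp Require Import all_classical all_reals all_analysis.

Set Implicit Arguments.
Unset Strict Implicit.
Unset Printing Implicit Defensive.

Import Order.TTheory GRing.Theory Num.Theory.
Import numFieldNormedType.Exports.

Local Open Scope classical_set_scope.
Local Open Scope ring_scope.

Definition psdmx (R : numDomainType) (n : nat) (S : 'M[R]_n) : Prop :=
  S^T = S /\ forall v : 'cV[R]_n, 0 <= (v^T *m S *m v) 0 0.

Definition pdmx (R : numDomainType) (n : nat) (S : 'M[R]_n) : Prop :=
  S^T = S /\ forall v : 'cV[R]_n, v != 0 -> 0 < (v^T *m S *m v) 0 0.

(* The matrix below is [B, A B, ..., A^(p-1) B]. *)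
Definition controllable (R : fieldType) (p : nat) (A : 'M[R]_p) (B : 'cV[R]_p)
  : Prop := \rank (\matrix_(i < p, j < p) (A ^+ j *m B) i 0) = p.

Definition stabilizable (R : rcfType) (p : nat) (A : 'M[R]_p) (B : 'cV[R]_p)
  : Prop :=
  exists L : 'rV[R]_p, forall z : complex R,
    eigenvalue (map_mx (real_complex R) (A - B *m L)) z -> `|z| < 1.

Section Controller.
Context {R : realType} {p : nat}.
Implicit Types (A Q X : 'M[R]_p) (B : 'cV[R]_p) (r : R) (N : nat).

Definition dare A B Q r X : Prop :=
  X = A^T *m X *m A + Q
      - A^T *m X *m B *m invmx (r%:M + B^T *m X *m B) *m B^T *m X *m A.

(* Np is represented by \sum_(i < N) p, the row dimension of a block column
   with N blocks of height p.  Rows are indexed from 0 here, so block i of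
   Upsilon is A^(i+1). *)
Definition Phi_mx A B N : 'M[R]_(\sum_(i < N) p, N) :=
  \mxcol_(i < N) \matrix_(a < p, j < N)
    (if (j <= i)%N then (A ^+ (i - j) *m B) a 0 else 0).

Definition Upsilon_mx A N : 'M[R]_(\sum_(i < N) p, p) :=
  \mxcol_(i < N) (A ^+ i.+1).

Definition Qbar_mx Q X N : 'M[R]_(\sum_(i < N) p) :=
  \mxdiag_(i < N) (if i.+1 == N then X else Q).

Definition Rbar_mx r N : 'M[R]_N := r%:M.

Definition W_mx A B Q X r N : 'M[R]_N :=
  Rbar_mx r N + (Phi_mx A B N)^T *m Qbar_mx Q X N *m Phi_mx A B N.

Definition F_mx A B Q X N : 'M[R]_(p, N) :=
  (Upsilon_mx A N)^T *m Qbar_mx Q X N *m Phi_mx A B N.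

Definition gain_mx A B Q X r N : 'M[R]_(N, p) :=
  invmx (W_mx A B Q X r N) *m (F_mx A B Q X N)^T.

Definition e1_mx N : 'cV[R]_N := \col_(i < N) (i == 0%N :> nat)%:R.

Definition shift_mx N : 'M[R]_N := \matrix_(i, j) (j == i.+1 :> nat)%:R.

(* [Abar_mx ... true] is the system matrix when the packet is dropped. *)
Definition Abar_mx A B Q X r N (dropped : bool) : 'M[R]_(p + N) :=
  let K := gain_mx A B Q X r N in
  if dropped then
    block_mx A (B *m (e1_mx N)^T *m shift_mx N) 0 (shift_mx N)
  else
    block_mx (A - B *m (e1_mx N)^T *m K) 0 (- K) 0.

Definition Bbar_mx (B2 : 'cV[R]_p) N : 'cV[R]_(p + N) := col_mx B2 0.

End Controller.

Section Probability.
Context {d : measure_display} {T : measurableType d} {R : realType}.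
Variable P : probability T R.

(* Entrywise expectation; [fine] is harmless on integrable entries. *)
Definition mx_expectation (m n : nat) (V : T -> 'M[R]_(m, n)) : 'M[R]_(m, n) :=
  \matrix_(i, j) fine 'E_P[fun t => V t i j].

Definition second_moment (n : nat) (V : T -> 'cV[R]_n) : 'M[R]_n :=
  mx_expectation (fun t => V t *m (V t)^T).

Definition covariance_mx (n : nat) (V : T -> 'cV[R]_n) : 'M[R]_n :=
  second_moment (fun t => V t - mx_expectation V).

Definition mutually_independent (I : eqType) (F : I -> set (set T)) : Prop :=
  forall (s : seq I) (E : I -> set T), uniq s ->
    (forall i, i \in s -> F i (E i)) ->
    P (\big[setI/setT]_(i <- s) E i) = (\prod_(i <- s) fine (P (E i)))%:E.

Definition sigma_rv d' (S : measurableType d') (X : T -> S) : set (set T) :=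
  preimage_set_system setT X measurable.

Definition sigma_rvec (n : nat) (V : T -> 'cV[R]_n) : set (set T) :=
  <<s \bigcup_i sigma_rv (fun t => V t i 0) >>.

(* The library's [normal_prob m 0] is not a point mass, hence the separate
   degenerate case. *)
Definition gaussian (X : {RV P >-> R}) : Prop :=
  (exists m s : R, s != 0 /\
     forall A, measurable A -> distribution P X A = normal_prob m s A) \/
  (exists m : R, forall A, measurable A -> distribution P X A = \d_m A).

Section Noise.
Variables (drop : nat -> {RV P >-> bool}) (w : nat -> {RV P >-> R}).

(* Index None stands for the initial state, Some (inl k) for the dropout
   variable at time k, and Some (inr k) for the disturbance at time k. *)
Definition source_sigma (n : nat) (V0 : T -> 'cV[R]_n)
    (i : option (nat + nat)) : set (set T) :=
  match i with
  | None => sigma_rvec V0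
  | Some (inl k) => sigma_rv (drop k)
  | Some (inr k) => sigma_rv (w k)
  end.

Definition admissible_initial (n : nat) (V0 : T -> 'cV[R]_n) : Prop :=
  (forall i, (fun t => V0 t i 0) \in Lfun P 2%:E) /\
  mutually_independent (source_sigma V0).

End Noise.

Definition ncs_dynamics (n : nat) (Abar : bool -> 'M[R]_n) (Bbar : 'cV[R]_n)
    (drop : nat -> T -> bool) (w : nat -> T -> R) (Theta : nat -> T -> 'cV[R]_n)
  : Prop :=
  forall k t, Theta k.+1 t = Abar (drop k t) *m Theta k t + w k t *: Bbar.

Definition set_initial_mode (d0 : bool) (drop : nat -> T -> bool)
  : nat -> T -> bool := fun k => if k is 0%N then fun=> d0 else drop k.

(* The limits mu and Q do not depend on the initial state Theta 0 nor on the
   initial mode d0, which replaces the random dropout variable at time 0. *)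
Definition mean_square_stable (n : nat) (Abar : bool -> 'M[R]_n)
    (Bbar : 'cV[R]_n) (drop : nat -> {RV P >-> bool}) (w : nat -> {RV P >-> R})
  : Prop :=
  exists (mu : 'cV[R]_n) (Q : 'M[R]_n),
    forall (d0 : bool) (Theta : nat -> T -> 'cV[R]_n),
      admissible_initial drop w (Theta 0%N) ->
      ncs_dynamics Abar Bbar (set_initial_mode d0 drop) w Theta ->
      mx_expectation (Theta k) @[k --> \oo] --> mu /\
      second_moment (Theta k) @[k --> \oo] --> Q.

End Probability.

(* Main.v *)
(* Theta(k) is a function of Theta(0) and of the noise strictly before time k,
   so it is independent of (d(k), omega(k)).  Expanding Theta(k+1) Theta(k+1)^T,
   the cross terms vanish because omega(k) is centred and independent of d(k),
   and the second moments obey the affine recursion S |-> L(S) with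
     L(S) = p_d A(1) S A(1)^T + (1 - p_d) A(0) S A(0)^T + sigma^2 B B^T.
   The limit is a fixed point of L by continuity, and the first two terms of L
   recombine into the mean and deviation terms of the formula.  Mean square
   stability speaks about a prescribed mode at time 0, whereas here d(0) is
   random: from time 1 on, the second moment is the mixture with weights
   p_d and 1 - p_d of the second moments for d(0) = 1 and d(0) = 0, and both
   have the same limit. *)
Require Import Defs.
From HB Require Import structures.
From mathcomp Require Import all_boot all_order all_algebra.
From mathcomp Require Import complex.
From mathcomp Require Import all_classical all_reals all_analysis.
From mathcomp Require Import measurable_realfun ring.

Set Implicit Arguments.
Unset Strict Implicit.
Unset Printing Implicit Defensive.

Import Order.TTheory GRing.Theory Num.Theory.
Import numFieldNormedType.Exports.

Local Open Scope classical_set_scope.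
Local Open Scope ring_scope.

(** * Independence of sigma-algebras generated by disjoint groups of sources *)

Section Independence.
Context {d : measure_display} {T : measurableType d} {R : realType}.
Variable P : probability T R.
Implicit Types G H : set (set T).

Definition independent_systems G H : Prop :=
  forall A B, G A -> H B -> P (A `&` B) = (P A * P B)%E.

Lemma independent_systemsC G H :
  independent_systems G H -> independent_systems H G.
Proof. by move=> GH A B HA GB; rewrite setIC GH// muleC. Qed.

Lemma g_sigma_algebra_sub_measurable G :
  G `<=` measurable -> <<s G >> `<=` measurable.
Proof. exact: smallest_sub (@sigma_algebra_measurable _ T). Qed.

(** This is Dynkin's argument: for fixed [B], two finite measures that agree on a pi-system
    containing the whole space agree on the sigma-algebra it generates. *)
Lemma independent_systems_sigma G H :
  G `<=` measurable -> H `<=` measurable -> setI_closed G -> G setT ->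
  independent_systems G H -> independent_systems <<s G >> H.
Proof.
move=> Gm Hm GI GT GH A B sGA HB.
have mB : measurable B := Hm _ HB.
have PB0 : (0 <= fine (P B))%R by rewrite fine_ge0.
(* The measures compared are [A] to [P (A] cap [B)] and [A] to [P B * P A]. The constant sequence
   [setT] serves as the exhausting sequence, which is where [G setT] enters. *)
pose m1 : {measure set T -> \bar R} := mrestr P mB.
pose m2 : {measure set T -> \bar R} := mscale (NngNum PB0) P.
have : m1 A = m2 A.
  apply: (g_sigma_algebra_measure_unique G Gm (fun=> setT)) => //.
  - by rewrite -subTset => x _; exists 0%N.
  - move=> C GC; rewrite /m1 /m2 /= /mrestr /mscale /= fineK ?fin_num_measure//.
    by rewrite GH// muleC.
  - by move=> _; rewrite /m1/= /mrestr setTI -ge0_fin_numE// fin_num_measure.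
rewrite /m1 /m2 /= /mrestr /mscale /= fineK ?fin_num_measure// => ->.
by rewrite muleC.
Qed.

Section Grouping.
Variables (I : eqType) (F : I -> set (set T)).
Hypothesis F_measurable : forall i, F i `<=` measurable.
Hypothesis FI : forall i, setI_closed (F i).
Hypothesis FT : forall i, F i setT.
Hypothesis F_indep : mutually_independent P F.
Implicit Type s : seq I.

(** A generating family for the joint information of the sources in [s]. A union of sigma-algebras
    is in general not stable under intersection, hence the pi-system [cylinders] below. *)
Definition pooled s : set (set T) := \bigcup_(i in [set` s]) F i.

(** These intersections, one event per source, are exactly the sets about which mutual independence
    speaks. *)
Definition cylinders s : set (set T) :=
  [set A | exists2 E : I -> set T, forall i, i \in s -> F i (E i) &
           A = \big[setI/setT]_(i <- s) E i].

Lemma cylinders_measurable s : cylinders s `<=` measurable.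
Proof.
move=> _ [E FE ->]; rewrite big_seq; elim/big_ind: _ => //.
  exact: measurableI.
by move=> i /FE /F_measurable.
Qed.

Lemma cylinders_setI_closed s : setI_closed (cylinders s).
Proof.
move=> _ _ [E FE ->] [E' FE' ->]; exists (fun i => E i `&` E' i).
  by move=> i si; apply: FI; [exact: FE|exact: FE'].
by rewrite big_split.
Qed.

Lemma cylindersT s : cylinders s setT.
Proof. by exists (fun=> setT) => // ; rewrite big1. Qed.

Lemma sub_pooled_cylinders s :
  uniq s -> <<s pooled s >> `<=` <<s cylinders s >>.
Proof.
move=> us; apply: smallest_sub; first exact: smallest_sigma_algebra.
move=> A [i /= si FA]; apply: sub_sigma_algebra.
(* A single event of source [i] is a cylinder once padded with the sure event at the other
   indices. *)
exists (fun j => if j == i then A else setT).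
  by move=> j _; case: eqP => [->|_] //; exact: FT.
by rewrite (bigD1_seq i)//= eqxx big1 ?setIT// => j /negPf->.
Qed.

(** Because the index lists are disjoint, the two choices of events glue into one choice [E2] on
    [s1 ++ s2], and the product given by mutual independence splits at the concatenation. *)
Lemma independent_cylinders s1 s2 :
  uniq (s1 ++ s2) -> independent_systems (cylinders s1) (cylinders s2).
Proof.
move=> u12 _ _ [E FE ->] [E' FE' ->].
have := u12; rewrite cat_uniq => /and3P[u1 /hasPn n12 u2].
pose E2 i := if i \in s1 then E i else E' i.
have e1 : \big[setI/setT]_(i <- s1) E i = \big[setI/setT]_(i <- s1) E2 i.
  by apply: eq_big_seq => i i1; rewrite /E2 i1.
have e2 : \big[setI/setT]_(i <- s2) E' i = \big[setI/setT]_(i <- s2) E2 i.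
  by apply: eq_big_seq => i i2; rewrite /E2 (negPf (n12 _ i2)).
have FE2 i : i \in s1 ++ s2 -> F i (E2 i).
  rewrite mem_cat /E2; case: ifP => [i1 _|_ /= i2]; [exact: FE|exact: FE'].
rewrite e1 e2 -big_cat/= !F_indep//.
- by rewrite big_cat/= EFinM.
- by move=> i i2; apply: FE2; rewrite mem_cat i2 orbT.
- by move=> i i1; apply: FE2; rewrite mem_cat i1.
Qed.

Lemma independent_pooled s1 s2 :
  uniq (s1 ++ s2) -> independent_systems <<s pooled s1 >> <<s pooled s2 >>.
Proof.
move=> u12; have := u12; rewrite cat_uniq => /and3P[u1 _ u2].
have mC s := @cylinders_measurable s.
have : independent_systems <<s cylinders s1 >> <<s cylinders s2 >>.
  (* The passage from cylinders to sigma-algebras is made on one side, then on the other by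
     symmetry. *)
  apply: independent_systems_sigma => //.
  - exact: g_sigma_algebra_sub_measurable.
  - exact: cylinders_setI_closed.
  - exact: cylindersT.
  apply: independent_systemsC; apply: independent_systems_sigma => //.
  - exact: cylinders_setI_closed.
  - exact: cylindersT.
  exact/independent_systemsC/independent_cylinders.
move=> h A B A1 B2; apply: h.
- exact: (sub_pooled_cylinders u1).
- exact: (sub_pooled_cylinders u2).
Qed.

Lemma pooled_measurable s : <<s pooled s >> `<=` measurable.
Proof.
by apply: g_sigma_algebra_sub_measurable => A [i _]; exact: F_measurable.
Qed.

Lemma sub_pooled s1 s2 :
  {subset s1 <= s2} -> <<s pooled s1 >> `<=` <<s pooled s2 >>.
Proof.
move=> s12; apply: smallest_sub; first exact: smallest_sigma_algebra.
move=> A [i /= i1 FA]; apply: sub_sigma_algebra.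
by exists i => //=; exact: s12.
Qed.

End Grouping.

End Independence.

(** * Expectation of a product of independent integrable variables *)

Section ProductExpectation.
Context {d : measure_display} {T : measurableType d} {R : realType}.
Variable P : probability T R.

Definition independent_rv (U V : T -> R) : Prop := forall A B,
  measurable A -> measurable B ->
  P (U @^-1` A `&` V @^-1` B) = (P (U @^-1` A) * P (V @^-1` B))%E.

Lemma Lfun_measurable (q : \bar R) (U : T -> R) :
  U \in Lfun P q -> measurable_fun setT U.
Proof. by rewrite inE => /andP[]; rewrite inE. Qed.

Lemma independent_rv_expectationM (U V : T -> R) :
  U \in Lfun P 1 -> V \in Lfun P 1 -> independent_rv U V ->
  (U \* V \in Lfun P 1) /\ ('E_P[U \* V] = 'E_P[U] * 'E_P[V])%E.
Proof.
move=> LU LV UV.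
have mU := Lfun_measurable LU; have mV := Lfun_measurable LV.
have iU := (Lfun1_integrable P U).1 LU; have iV := (Lfun1_integrable P V).1 LV.
pose U' : {RV P >-> R} := HB.pack U (isMeasurableFun.Build _ _ _ _ U mU).
pose V' : {RV P >-> R} := HB.pack V (isMeasurableFun.Build _ _ _ _ V mV).
pose W t := (U t, V t).
have mW : measurable_fun setT W by exact: measurable_fun_pair.
pose W' : {RV P >-> (R * R)%type} :=
  HB.pack W (isMeasurableFun.Build _ _ _ _ W mW).
pose m1 := distribution P U'; pose m2 := distribution P V'.
(* Independence gives the agreement on rectangles, which determines the product measure. *)
have prodE X : measurable X -> (m1 \x m2)%E X = distribution P W' X.
  apply: product_measure_unique => A B mA mB.
  by rewrite /distribution /pushforward /= -UV.
pose f (z : R * R) : \bar R := (z.1 * z.2)%:E.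
have mf : measurable_fun [set: R * R] f.
  by apply/measurable_EFinP; exact: measurable_funM.
have int1 : (\int[m1]_x `|x%:E| < +oo)%E.
  have /integrableP[_] := iU.
  by rewrite (ge0_integral_pushforward mU)//=; exact: measurableT_comp.
have int2 : (\int[m2]_x `|x%:E| < +oo)%E.
  have /integrableP[_] := iV.
  by rewrite (ge0_integral_pushforward mV)//=; exact: measurableT_comp.
(* The iterated integral of [|x y|] factors into the two finite absolute first moments. *)
have intf : (m1 \x m2)%E.-integrable setT f.
  apply/integrable12ltyP => //.
  under eq_integral => x _.
    under eq_integral => y _ do rewrite /f/= normrM EFinM.
    rewrite ge0_integralZl//; last first.
      by apply/measurable_EFinP; exact: normr_measurable.
    over.
  rewrite ge0_integralZr//=; last 2 first.
    by apply/measurable_EFinP; exact: normr_measurable.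
    exact: integral_ge0.
  by rewrite lte_mul_pinfty// ?integral_ge0// ge0_fin_numE// integral_ge0.
have intUV : P.-integrable setT (f \o W).
  apply/integrableP; split; first exact: measurableT_comp.
  have /integrableP[_] := intf.
  rewrite (eq_measure_integral (distribution P W')); last first.
    by move=> A mA _; exact: prodE.
  rewrite (ge0_integral_pushforward mW)//.
  exact: measurableT_comp.
split; first exact/Lfun1_integrable.
rewrite unlock -/(f \o W).
(* The expectation moves to the joint law, then to the product law, where it becomes an iterated
   integral. *)
transitivity (\int[distribution P W']_z f z)%E.
  by rewrite (integral_pushforward mW).
rewrite -(eq_measure_integral (distribution P W') (m1 := (m1 \x m2)%E));
  last by move=> A mA _; exact: prodE.
rewrite -integral12_prod_meas1//= /fubini_F.
have EU : (\int[m1]_x x%:E = \int[P]_t (U t)%:E)%E.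
  by rewrite (integral_pushforward mU).
have EV : (\int[m2]_x x%:E = \int[P]_t (V t)%:E)%E.
  by rewrite (integral_pushforward mV).
have i1 : m1.-integrable setT EFin by exact: (integrable_pushforward mU).
have i2 : m2.-integrable setT EFin by exact: (integrable_pushforward mV).
under eq_integral => x _.
  under eq_integral => y _ do rewrite /f/= EFinM.
  rewrite integralZl//.
  over.
rewrite -EU -EV -[X in (_ * X)%E]fineK ?integrable_fin_num// -integralZr//.
by rewrite fineK ?integrable_fin_num.
Qed.

End ProductExpectation.

(** * Entrywise integrability and linearity of matrix expectations *)

Section MatrixExpectation.
Context {d : measure_display} {T : measurableType d} {R : realType}.
Variable P : probability T R.

Lemma Lfun_bigsum (q : \bar R) (q1 : (1 <= q)%E) (I : Type) (s : seq I)
    (f : I -> T -> R) :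
  (forall i, f i \in Lfun P q) -> (fun t => \sum_(i <- s) f i t) \in Lfun P q.
Proof.
move=> Lf; rewrite -fct_sumE; have [L0 LD] := Lfun_addr_closed P q1.
by elim/big_ind: _.
Qed.

Lemma Lfun2_sqr_integrable (f : T -> R) :
  measurable_fun setT f -> P.-integrable setT (fun t => (f t ^+ 2)%:E) ->
  f \in Lfun P 2%:E.
Proof.
move=> mf /integrableP[_ foo].
rewrite inE; apply/andP; split; rewrite inE//=.
rewrite /finite_norm unlock poweR_lty//.
under eq_integral => t _ do rewrite /= powR_mulrn// -normrX.
exact: foo.
Qed.

(** The square is dominated by that of [f], whatever the dependence between [S] and [f]. *)
Lemma Lfun2_mul_indicator (S : set T) (f : T -> R) :
  measurable S -> f \in Lfun P 2%:E -> (fun t => \1_S t * f t) \in Lfun P 2%:E.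
Proof.
move=> mS Lf; have := Lf; rewrite inE => /andP[]; rewrite inE => mf _.
have mSf : measurable_fun setT (fun t => \1_S t * f t).
  exact: measurable_funM.
apply: Lfun2_sqr_integrable => //.
apply: le_integrable (Lfun2_integrable_sqr Lf) => //=.
  by apply/measurable_EFinP; exact: measurable_funX.
move=> t _; rewrite lee_fin indicE; case: (t \in S); rewrite ?mul1r//.
by rewrite mul0r expr0n normr0.
Qed.

Lemma fine_expectation_sum (I : Type) (s : seq I) (f : I -> T -> R) :
  (forall i, f i \in Lfun P 1) ->
  fine 'E_P[fun t => \sum_(i <- s) f i t] = \sum_(i <- s) fine 'E_P[f i].
Proof.
move=> Lf; elim: s => [|i s IH].
  rewrite big_nil [X in 'E_P[X]%E](_ : _ = cst 0) ?expectation_cst//.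
  by apply/funext => t; rewrite big_nil.
rewrite big_cons -IH -fineD ?expectation_fin_num ?Lfun_bigsum//.
rewrite -expectationD ?Lfun_bigsum//; congr (fine (expectation _ _)).
by apply/funext => t; rewrite big_cons.
Qed.

Definition mx_integrable (m n : nat) (V : T -> 'M[R]_(m, n)) : Prop :=
  forall i j, (fun t => V t i j) \in Lfun P 1.

Lemma mx_integrableD (m n : nat) (U V : T -> 'M[R]_(m, n)) :
  mx_integrable U -> mx_integrable V -> mx_integrable (fun t => U t + V t).
Proof.
move=> iU iV i j; have [_ LD] := Lfun_addr_closed P (lexx 1%E).
rewrite (_ : (fun t => _) = (fun t => U t i j) + (fun t => V t i j)).
  exact: LD.
by apply/funext => t; rewrite mxE.
Qed.

Lemma mx_expectationD (m n : nat) (U V : T -> 'M[R]_(m, n)) :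
  mx_integrable U -> mx_integrable V ->
  mx_expectation P (fun t => U t + V t) =
  mx_expectation P U + mx_expectation P V.
Proof.
move=> iU iV; apply/matrixP => i j; rewrite !mxE.
rewrite -fineD ?expectation_fin_num// -expectationD//.
by congr (fine (expectation _ _)); apply/funext => t; rewrite mxE.
Qed.

Lemma expectation_scale (f : T -> R) (c : R) : f \in Lfun P 1 ->
  fine 'E_P[fun t => c * f t] = c * fine 'E_P[f].
Proof.
move=> Lf; rewrite (_ : (fun t => _) = c \o* f).
  by rewrite expectationZl// fineM// expectation_fin_num.
by apply/funext => t /=; rewrite mulrC.
Qed.

Lemma Lfun1_scale (f : T -> R) (c : R) :
  f \in Lfun P 1 -> (fun t => c * f t) \in Lfun P 1.
Proof.
move=> Lf; rewrite (_ : (fun t => _) = c \o* f); first exact: Lfun_scale.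
by apply/funext => t /=; rewrite mulrC.
Qed.

Lemma mx_integrable_mull (m n q : nat) (C : 'M[R]_(m, n))
    (V : T -> 'M[R]_(n, q)) :
  mx_integrable V -> mx_integrable (fun t => C *m V t).
Proof.
move=> iV i j; rewrite (_ : (fun t => _) = (fun t => \sum_k C i k * V t k j)).
  by apply: Lfun_bigsum => // k; exact: Lfun1_scale.
by apply/funext => t; rewrite mxE.
Qed.

Lemma mx_expectation_mull (m n q : nat) (C : 'M[R]_(m, n))
    (V : T -> 'M[R]_(n, q)) : mx_integrable V ->
  mx_expectation P (fun t => C *m V t) = C *m mx_expectation P V.
Proof.
move=> iV; apply/matrixP => i j; rewrite !mxE.
rewrite [X in 'E_P[X]%E](_ : _ = (fun t => \sum_k C i k * V t k j)).
  rewrite fine_expectation_sum; last by move=> k; exact: Lfun1_scale.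
  by apply: eq_bigr => k _; rewrite mxE expectation_scale.
by apply/funext => t; rewrite mxE.
Qed.

Lemma mx_integrable_trmx (m n : nat) (V : T -> 'M[R]_(m, n)) :
  mx_integrable V -> mx_integrable (fun t => (V t)^T).
Proof.
move=> iV i j; rewrite (_ : (fun t => _) = (fun t => V t j i))//.
by apply/funext => t; rewrite mxE.
Qed.

Lemma mx_expectation_trmx (m n : nat) (V : T -> 'M[R]_(m, n)) :
  mx_expectation P (fun t => (V t)^T) = (mx_expectation P V)^T.
Proof.
apply/matrixP => i j; rewrite !mxE; congr (fine (expectation _ _)).
by apply/funext => t; rewrite mxE.
Qed.

Lemma mx_integrable_mulr (m n q : nat) (V : T -> 'M[R]_(m, n))
    (C : 'M[R]_(n, q)) :
  mx_integrable V -> mx_integrable (fun t => V t *m C).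
Proof.
move=> /mx_integrable_trmx/(mx_integrable_mull C^T)/mx_integrable_trmx.
by under eq_fun do rewrite trmx_mul !trmxK.
Qed.

Lemma mx_expectation_mulr (m n q : nat) (V : T -> 'M[R]_(m, n))
    (C : 'M[R]_(n, q)) : mx_integrable V ->
  mx_expectation P (fun t => V t *m C) = mx_expectation P V *m C.
Proof.
move=> /mx_integrable_trmx iV; apply: trmx_inj.
rewrite -mx_expectation_trmx trmx_mul -mx_expectation_trmx.
by rewrite -mx_expectation_mull//; under eq_fun do rewrite trmx_mul.
Qed.

(** Each entry is a product of two variables that are only known to be integrable; independence is
    what keeps the product integrable. *)
Lemma mx_integrable_scale (m n : nat) (f : T -> R) (V : T -> 'M[R]_(m, n)) :
  f \in Lfun P 1 -> mx_integrable V ->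
  (forall i j, independent_rv P f (fun t => V t i j)) ->
  mx_integrable (fun t => f t *: V t).
Proof.
move=> Lf iV fV i j.
have [LfV _] := independent_rv_expectationM Lf (iV i j) (fV i j).
rewrite (_ : (fun t => _) = f \* (fun t => V t i j))//.
by apply/funext => t; rewrite mxE.
Qed.

Lemma mx_expectation_scale (m n : nat) (f : T -> R) (V : T -> 'M[R]_(m, n)) :
  f \in Lfun P 1 -> mx_integrable V ->
  (forall i j, independent_rv P f (fun t => V t i j)) ->
  mx_expectation P (fun t => f t *: V t) =
  fine 'E_P[f] *: mx_expectation P V.
Proof.
move=> Lf iV fV; apply/matrixP => i j; rewrite !mxE.
have [_ EfV] := independent_rv_expectationM Lf (iV i j) (fV i j).
rewrite -fineM ?expectation_fin_num// -EfV; congr (fine (expectation _ _)).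
by apply/funext => t; rewrite mxE.
Qed.

Lemma mx_integrable_scale_cst (m n : nat) (f : T -> R) (C : 'M[R]_(m, n)) :
  f \in Lfun P 1 -> mx_integrable (fun t => f t *: C).
Proof.
move=> Lf i j; rewrite (_ : (fun t => _) = (fun t => C i j * f t)).
  exact: Lfun1_scale.
by apply/funext => t; rewrite mxE mulrC.
Qed.

Lemma mx_expectation_scale_cst (m n : nat) (f : T -> R) (C : 'M[R]_(m, n)) :
  f \in Lfun P 1 ->
  mx_expectation P (fun t => f t *: C) = fine 'E_P[f] *: C.
Proof.
move=> Lf; apply/matrixP => i j; rewrite !mxE mulrC -expectation_scale//.
by congr (fine (expectation _ _)); apply/funext => t; rewrite mxE mulrC.
Qed.

End MatrixExpectation.

(** * Measurability with respect to the information carried by some of the sources *)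

Section Adapted.
Context {d : measure_display} {T : measurableType d} {R : realType}.
Variable P : probability T R.

(* Measurability with respect to the sigma-algebra generated by [G], which may
   be coarser than that of [T]. *)
Definition adapted {d'} {S : measurableType d'} (G : set (set T)) (f : T -> S)
  : Prop := measurable_fun [set: g_sigma_algebraType G] f.

Lemma sigma_rv_measurable d' (S : measurableType d') (Z : T -> S) :
  measurable_fun setT Z -> sigma_rv Z `<=` measurable.
Proof. by move=> mZ _ [A mA <-]; exact: mZ. Qed.

Lemma adapted_preimage {d'} {S : measurableType d'} (G : set (set T))
    (f : T -> S) (A : set S) :
  adapted G f -> measurable A -> <<s G >> (f @^-1` A).
Proof. by move=> mf mA; have := mf measurableT _ mA; rewrite setTI. Qed.

Lemma adapted_independent (G H : set (set T)) (f g : T -> R) :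
  independent_systems P <<s G >> <<s H >> -> adapted G f -> adapted H g ->
  independent_rv P f g.
Proof. by move=> GH fG gH A B mA mB; apply: GH; exact: adapted_preimage. Qed.

Lemma sub_adapted {d'} {S : measurableType d'} (G H : set (set T))
    (f : T -> S) :
  <<s G >> `<=` <<s H >> -> adapted G f -> adapted H f.
Proof.
move=> GH fG _ A mA; rewrite setTI; apply: GH.
exact: (adapted_preimage fG).
Qed.

Lemma adapted_bool (G : set (set T)) (f : T -> bool) :
  <<s G >> (f @^-1` [set true]) -> adapted G f.
Proof.
by move=> fG; apply: (@measurable_fun_bool _ _ _ _ true); rewrite setTI.
Qed.

Lemma adapted_negb (G : set (set T)) (b : T -> bool) :
  adapted G b -> adapted G (fun t => ~~ b t).
Proof. by move=> ab; exact: (measurableT_comp (f := negb)) ab. Qed.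

End Adapted.

Section AdaptedMatrices.
Context {d : measure_display} {T : measurableType d} {R : realType}.
Variable G : set (set T).

Definition mx_adapted (m n : nat) (V : T -> 'M[R]_(m, n)) : Prop :=
  forall i j, adapted G (fun t => V t i j).

Lemma mx_adapted_cst (m n : nat) (C : 'M[R]_(m, n)) : mx_adapted (fun=> C).
Proof. by move=> i j; exact: measurable_cst. Qed.

Lemma mx_adaptedD (m n : nat) (U V : T -> 'M[R]_(m, n)) :
  mx_adapted U -> mx_adapted V -> mx_adapted (fun t => U t + V t).
Proof.
move=> aU aV i j; rewrite /adapted; under eq_fun do rewrite mxE.
exact: measurable_funD (aU i j) (aV i j).
Qed.

Lemma mx_adaptedM (m n q : nat) (U : T -> 'M[R]_(m, n))
    (V : T -> 'M[R]_(n, q)) :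
  mx_adapted U -> mx_adapted V -> mx_adapted (fun t => U t *m V t).
Proof.
move=> aU aV i j; rewrite /adapted; under eq_fun do rewrite mxE.
apply: (@measurable_sum _ (g_sigma_algebraType G)) => k.
exact: measurable_funM (aU i k) (aV k j).
Qed.

Lemma mx_adapted_trmx (m n : nat) (V : T -> 'M[R]_(m, n)) :
  mx_adapted V -> mx_adapted (fun t => (V t)^T).
Proof.
by move=> aV i j; rewrite /adapted; under eq_fun do rewrite mxE; exact: aV.
Qed.

Lemma mx_adapted_scale (m n : nat) (f : T -> R) (V : T -> 'M[R]_(m, n)) :
  adapted G f -> mx_adapted V -> mx_adapted (fun t => f t *: V t).
Proof.
move=> af aV i j; rewrite /adapted; under eq_fun do rewrite mxE.
exact: measurable_funM af (aV i j).
Qed.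

Lemma adapted_natr_bool (b : T -> bool) :
  adapted G b -> adapted G (fun t => (b t)%:R : R).
Proof.
move=> ab; apply: (@measurableT_comp _ _ _ _ _ _ (fun c : bool => c%:R : R)) ab.
by [].
Qed.

End AdaptedMatrices.

Lemma natr_bool_indic (T : Type) (R : pzRingType) (b : T -> bool) (t : T) :
  (b t)%:R = \1_(b @^-1` [set true]) t :> R.
Proof.
rewrite indicE; congr (nat_of_bool _)%:R.
by case E: (b t); [rewrite mem_set|rewrite memNset//= E].
Qed.

(** * Indicators of Boolean random variables *)

Section BooleanVariables.
Context {d : measure_display} {T : measurableType d} {R : realType}.
Variables (P : probability T R) (b : T -> bool).
Hypothesis mb : measurable_fun setT b.

Let mb_true : measurable (b @^-1` [set true]).
Proof. by rewrite -[X in measurable X]setTI; exact: mb. Qed.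

Lemma Lfun2_mul_bool (f : T -> R) :
  f \in Lfun P 2%:E -> (fun t => (b t)%:R * f t) \in Lfun P 2%:E.
Proof.
move=> /(Lfun2_mul_indicator mb_true).
by under eq_fun do rewrite -natr_bool_indic.
Qed.

Lemma fine_expectation_bool :
  fine 'E_P[fun t => (b t)%:R] = fine (P (b @^-1` [set true])).
Proof.
rewrite -expectation_indic//; congr (fine (expectation _ _)).
by apply/funext => t; exact: natr_bool_indic.
Qed.

End BooleanVariables.

(** Used with [c] the disturbance: the three terms are of degree 0, 1 and 2 in it, and the middle
    one will have zero expectation. *)
Lemma outer_product_addZ (R : comPzRingType) (n : nat) (u v : 'cV[R]_n)
    (c : R) :
  (u + c *: v) *m (u + c *: v)^T =
  u *m u^T + c *: (u *m v^T + (u *m v^T)^T) + c ^+ 2 *: (v *m v^T).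
Proof.
rewrite [(_ + _)^T]linearD/= [(_ *: _)^T]linearZ/= mulmxDl !mulmxDr.
rewrite -!scalemxAl -!scalemxAr scalerA -expr2 trmx_mul trmxK scalerDr.
by rewrite !addrA.
Qed.

(** * The switched linear system: sources of randomness and adaptedness of the state *)

Section SwitchedSystem.
Context {dT : measure_display} {T : measurableType dT} {R : realType}.
Variable P : probability T R.
Variables (drop : nat -> {RV P >-> bool}) (w : nat -> {RV P >-> R}).
Variables (n : nat) (Abar : bool -> 'M[R]_n) (Bbar : 'cV[R]_n).
Variables (mode : nat -> T -> bool) (Theta : nat -> T -> 'cV[R]_n) (sigma : R).
Hypothesis w_mean : forall k, ('E_P[w k] = 0)%E.
Hypothesis w_var : forall k, ('V_P[w k] = (sigma ^+ 2)%:E)%E.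
Hypothesis init : admissible_initial drop w (Theta 0%N).
(** The switching signal is any signal with [mode k] determined by [drop k]. This covers both the
    random dropouts and the variant whose mode at time 0 is prescribed. *)
Hypothesis mode_drop : forall k, sigma_rv (drop k) (mode k @^-1` [set true]).
Hypothesis dyn : ncs_dynamics Abar Bbar mode w Theta.

Let F := source_sigma drop w (Theta 0%N).

Definition noise_at (k : nat) : seq (option (nat + nat)) :=
  [:: Some (inl k); Some (inr k)].

(** The sources that determine the state at time [k]: the initial state and the noise strictly
    before [k]. *)
Fixpoint past (k : nat) : seq (option (nat + nat)) :=
  if k is l.+1 then noise_at l ++ past l else [:: None].

Lemma past_lt k i : i \in past k ->
  match i with Some (inl j) | Some (inr j) => (j < k)%N | None => true end.
Proof.
elim: k i => [|k IH] i /=; first by rewrite inE => /eqP ->.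
rewrite !inE => /or3P[/eqP->|/eqP->|/IH] //.
by case: i {IH} => [[j|j]|] // /ltnW.
Qed.

Lemma past_uniq k : uniq (past k).
Proof.
elim: k => [//|k IH] /=; rewrite IH inE/= andbT.
by apply/andP; split; apply/negP => /past_lt; rewrite ltnn.
Qed.

Lemma source_sigma_algebra i : sigma_algebra setT (F i).
Proof.
case: i => [[k|k]|] /=.
- exact/sigma_algebra_preimage/sigma_algebra_measurable.
- exact/sigma_algebra_preimage/sigma_algebra_measurable.
- exact: smallest_sigma_algebra.
Qed.

(** Each source family is already a sigma-algebra, so it equals the one it generates and inherits
    its closure properties. *)
Lemma source_setI_closed i : setI_closed (F i).
Proof.
rewrite -(sigma_algebra_id (source_sigma_algebra i)).
exact: (@measurableI _ (g_sigma_algebraType (F i))).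
Qed.

Lemma sourceT i : F i setT.
Proof.
rewrite -(sigma_algebra_id (source_sigma_algebra i)).
exact: (@measurableT _ (g_sigma_algebraType (F i))).
Qed.

Lemma Theta0_Lfun2 i : (fun t => Theta 0%N t i 0) \in Lfun P 2%:E.
Proof. by have [+ _] := init. Qed.

Lemma source_measurable i : F i `<=` measurable.
Proof.
case: i => [[k|k]|] /=.
- exact: sigma_rv_measurable.
- exact: sigma_rv_measurable.
- apply: g_sigma_algebra_sub_measurable => A [i _]; apply: sigma_rv_measurable.
  exact: Lfun_measurable (Theta0_Lfun2 i).
Qed.

Let indep_pooled s1 s2 : uniq (s1 ++ s2) ->
  independent_systems P <<s pooled F s1 >> <<s pooled F s2 >>.
Proof.
apply: independent_pooled.
- exact: source_measurable.
- exact: source_setI_closed.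
- exact: sourceT.
- by have [] := init.
Qed.

Lemma pooled_mem s i A : i \in s -> F i A -> <<s pooled F s >> A.
Proof. by move=> si FA; apply: sub_sigma_algebra; exists i. Qed.

Lemma mode_adapted k s : Some (inl k) \in s -> adapted (pooled F s) (mode k).
Proof.
by move=> ks; apply: adapted_bool; exact: pooled_mem ks (mode_drop k).
Qed.

Lemma mode_measurable k : measurable_fun setT (mode k).
Proof.
apply: (@measurable_fun_bool _ _ _ _ true); rewrite setTI.
exact: sigma_rv_measurable (mode_drop k).
Qed.

Lemma w_adapted k s : Some (inr k) \in s -> adapted (pooled F s) (w k).
Proof.
move=> ks _ A mA; apply: (pooled_mem ks); exists A => //.
Qed.

Lemma Theta0_adapted : mx_adapted (pooled F (past 0)) (Theta 0%N).
Proof.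
move=> i j; rewrite ord1 => _ A mA; apply: (@pooled_mem _ None) => //=.
by apply: sub_sigma_algebra; exists i => //; exists A.
Qed.

(** The case distinction on the mode becomes a sum with indicator coefficients, a form to which
    closure under sums and products applies. *)
Lemma dyn_split k t : Theta k.+1 t =
  (mode k t)%:R *: (Abar true *m Theta k t) +
  (~~ mode k t)%:R *: (Abar false *m Theta k t) + w k t *: Bbar.
Proof.
by rewrite dyn; case: (mode k t); rewrite /= scale1r scale0r ?addr0 ?add0r.
Qed.

Lemma Theta_adapted k : mx_adapted (pooled F (past k)) (Theta k).
Proof.
elim: k => [|k IH]; first exact: Theta0_adapted.
have sub : {subset past k <= past k.+1}.
  by move=> i ik; rewrite /= !inE ik !orbT.
have {}IH : mx_adapted (pooled F (past k.+1)) (Theta k).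
  by move=> i j; apply: sub_adapted (IH i j); exact: sub_pooled.
have mk : adapted (pooled F (past k.+1)) (mode k).
  by apply: mode_adapted; rewrite /= inE eqxx.
rewrite (funext (@dyn_split k) : Theta k.+1 = _).
apply: mx_adaptedD; [apply: mx_adaptedD|]; apply: mx_adapted_scale.
- exact: adapted_natr_bool.
- by apply: mx_adaptedM => //; exact: mx_adapted_cst.
- by apply: adapted_natr_bool; exact: adapted_negb.
- by apply: mx_adaptedM => //; exact: mx_adapted_cst.
- by apply: w_adapted; rewrite /= !inE eqxx orbT.
- exact: mx_adapted_cst.
Qed.

(** * Square integrability of the disturbance and of the state *)

Lemma w_sqr_expectation k : ('E_P[(fun t => w k t ^+ 2)%R] = (sigma ^+ 2)%:E)%E.
Proof.
rewrite -(w_var k) /variance covariance.unlock w_mean.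
congr (expectation _ _); apply/funext => t /=.
by rewrite -[RHS]/((w k t - 0) * (w k t - 0))%R subr0 expr2.
Qed.

(** The square is nonnegative and its expectation is the real number [sigma ^+ 2], so its integral
    is finite. *)
Lemma w_Lfun2 k : (w k : T -> R) \in Lfun P 2%:E.
Proof.
apply: Lfun2_sqr_integrable => //; apply/integrableP; split.
  by apply/measurable_EFinP; exact: measurable_funX.
have := w_sqr_expectation k; rewrite unlock => E.
under eq_integral => t _ do rewrite /= ger0_norm ?sqr_ge0//.
by rewrite E ltry.
Qed.

Let Lfun2_1 (f : T -> R) : f \in Lfun P 2%:E -> f \in Lfun P 1.
Proof. by apply: Lfun_subset12; exact: fin_num_measure. Qed.

(** Induction on time: square integrability survives fixed linear maps, indicator factors and the
    addition of the disturbance. *)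
Lemma Theta_Lfun2 k i : (fun t => Theta k t i 0) \in Lfun P 2%:E.
Proof.
elim: k i => [|k IH] i; first exact: Theta0_Lfun2.
have [_ LD] := Lfun_addr_closed P (lee1n 2).
have LA (b : T -> bool) (A : 'M[R]_n) : measurable_fun setT b ->
    (fun t => ((b t)%:R *: (A *m Theta k t)) i 0) \in Lfun P 2%:E.
  move=> mb; under eq_fun do rewrite mxE; apply: Lfun2_mul_bool => //.
  under eq_fun do rewrite mxE; apply: Lfun_bigsum; first exact: lee1n.
  move=> j; rewrite (_ : (fun t => _) = A i j \o* (fun t => Theta k t j 0)).
    by apply: Lfun_scale => //; exact: ler1n.
  by apply/funext => t /=; rewrite mulrC.
under eq_fun do rewrite dyn_split 2!mxE.
apply: (LD (fun t => _ + _)); first apply: (LD (fun t => _)).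
- by apply: LA; exact: mode_measurable.
- by apply: LA; apply: measurableT_comp (mode_measurable k).
- rewrite (_ : (fun t => _) = Bbar i 0 \o* w k).
    by apply: Lfun_scale (w_Lfun2 k); exact: ler1n.
  by apply/funext => t /=; rewrite mxE mulrC.
Qed.

Lemma mx_integrable_outer k :
  mx_integrable P (fun t => Theta k t *m (Theta k t)^T).
Proof.
move=> i j; under eq_fun do rewrite mxE.
apply: Lfun_bigsum => // l; rewrite (ord1 l); under eq_fun do rewrite mxE.
exact: Lfun2_mul_Lfun1 (Theta_Lfun2 k i) (Theta_Lfun2 k j).
Qed.

Lemma mx_integrable_Theta k : mx_integrable P (Theta k).
Proof. by move=> i j; rewrite ord1; exact/Lfun2_1/Theta_Lfun2. Qed.

(** * One step of the second moment, split according to the current mode *)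

Let mode_is (k : nat) (c : bool) (t : T) : bool := mode k t == c.

Lemma mode_is_adapted k c s :
  Some (inl k) \in s -> adapted (pooled F s) (mode_is k c).
Proof.
move=> /mode_adapted ms; rewrite /mode_is; case: c.
  by rewrite (_ : (fun t => _) = mode k)//; apply/funext => t; rewrite eqb_id.
rewrite (_ : (fun t => _) = (fun t => ~~ mode k t)); first exact: adapted_negb.
by apply/funext => t; rewrite eqbF_neg.
Qed.

Lemma mode_is_measurable k c : measurable_fun setT (mode_is k c).
Proof.
move=> _ A mA; rewrite setTI.
have /mode_is_adapted/adapted_preimage ms : Some (inl k) \in noise_at k.
  by rewrite inE eqxx.
apply: (pooled_measurable source_measurable (s := noise_at k)).
exact: ms.
Qed.

Lemma Lfun2_mode_is k c : (fun t => (mode_is k c t)%:R : R) \in Lfun P 2%:E.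
Proof.
have := Lfun2_mul_bool (mode_is_measurable k c) (Lfun_cst P 1 2).
by under eq_fun do rewrite mulr1.
Qed.

Lemma Lfun2_mode_is_w k c :
  (fun t => (mode_is k c t)%:R * w k t) \in Lfun P 2%:E.
Proof. by apply: Lfun2_mul_bool (w_Lfun2 k); exact: mode_is_measurable. Qed.

Lemma noise_past_independent k (f g : T -> R) :
  adapted (pooled F (noise_at k)) f -> adapted (pooled F (past k)) g ->
  independent_rv P f g.
(* [past k.+1] unfolds to [noise_at k ++ past k], so its lack of repetitions is the disjointness
   required. *)
Proof. by apply: adapted_independent; exact/indep_pooled/(past_uniq k.+1). Qed.

(** The mode and the disturbance at the same time come from distinct sources, so the expectation
    factors, and the disturbance is centred. *)
Lemma mode_is_w_expectation k c :
  fine 'E_P[fun t => (mode_is k c t)%:R * w k t] = 0.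
Proof.
have mw : independent_rv P (fun t => (mode_is k c t)%:R) (w k).
  apply: (@adapted_independent _ _ _ _ (pooled F [:: Some (inl k)])
    (pooled F [:: Some (inr k)])).
  - exact: indep_pooled.
  - by apply: adapted_natr_bool; apply: mode_is_adapted; rewrite mem_head.
  - by apply: w_adapted; rewrite mem_head.
have [_] := independent_rv_expectationM (Lfun2_1 (Lfun2_mode_is k c))
  (Lfun2_1 (w_Lfun2 k)) mw.
by rewrite w_mean mule0 => ->.
Qed.

(** The part of the outer product at time [k.+1] that comes from mode [c], without the quadratic
    disturbance term, which is the same in both modes. *)
Let branch (k : nat) (c : bool) (t : T) : 'M[R]_n :=
  (mode_is k c t)%:R *:
    (Abar c *m (Theta k t *m (Theta k t)^T) *m (Abar c)^T) +
  ((mode_is k c t)%:R * w k t) *: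
    (Abar c *m Theta k t *m Bbar^T + (Abar c *m Theta k t *m Bbar^T)^T).

Lemma outer_branch k t : Theta k.+1 t *m (Theta k.+1 t)^T =
  branch k true t + branch k false t + (w k t ^+ 2) *: (Bbar *m Bbar^T).
Proof.
rewrite dyn outer_product_addZ trmx_mul !mulmxA /branch /mode_is.
by case: (mode k t); rewrite /= !(scale1r, scale0r, mul1r, mul0r) ?addr0 ?add0r
  !mulmxA.
Qed.

(** In both summands the scalar coefficient depends on the noise at time [k] and the matrix on the
    past, so the expectation factors. The coefficient of the cross terms has mean zero. *)
Lemma branch_expectation k c :
  mx_integrable P (branch k c) /\
  mx_expectation P (branch k c) =
  fine (P (mode_is k c @^-1` [set true])) *:
    (Abar c *m second_moment P (Theta k) *m (Abar c)^T).
Proof.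
have Ind1 := Lfun2_1 (Lfun2_mode_is k c).
have Ind2 := Lfun2_1 (Lfun2_mode_is_w k c).
have iO := @mx_integrable_outer k; have iT := @mx_integrable_Theta k.
have aT := @Theta_adapted k.
have aI : adapted (pooled F (noise_at k)) (fun t => (mode_is k c t)%:R : R).
  by apply: adapted_natr_bool; apply: mode_is_adapted; rewrite mem_head.
have aIw : adapted (pooled F (noise_at k))
    (fun t => (mode_is k c t)%:R * w k t).
  apply: (@measurable_funM _ (g_sigma_algebraType _)) => //.
  by apply: w_adapted; rewrite !inE eqxx orbT.
pose U t := Abar c *m (Theta k t *m (Theta k t)^T) *m (Abar c)^T.
pose V t := Abar c *m Theta k t *m Bbar^T.
pose W t := V t + (V t)^T.
have iAO : mx_integrable P (fun t => Abar c *m (Theta k t *m (Theta k t)^T)).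
  exact: mx_integrable_mull.
have iU : mx_integrable P U by exact: mx_integrable_mulr.
have iV : mx_integrable P V.
  by apply/mx_integrable_mulr/mx_integrable_mull.
have iW : mx_integrable P W.
  by apply: mx_integrableD => //; exact: mx_integrable_trmx.
have aU : mx_adapted (pooled F (past k)) U.
  apply: mx_adaptedM; last exact: mx_adapted_cst.
  apply: mx_adaptedM; first exact: mx_adapted_cst.
  by apply: mx_adaptedM => //; exact: mx_adapted_trmx.
have aV : mx_adapted (pooled F (past k)) V.
  apply: mx_adaptedM; last exact: mx_adapted_cst.
  by apply: mx_adaptedM => //; exact: mx_adapted_cst.
have aW : mx_adapted (pooled F (past k)) W.
  by apply: mx_adaptedD => //; exact: mx_adapted_trmx.
have jU i j := noise_past_independent aI (aU i j).
have jW i j := noise_past_independent aIw (aW i j).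
have s1 := mx_integrable_scale Ind1 iU jU.
have s2 := mx_integrable_scale Ind2 iW jW.
split; first exact: mx_integrableD s1 s2.
rewrite (mx_expectationD s1 s2) (mx_expectation_scale Ind1 iU jU).
rewrite (mx_expectation_scale Ind2 iW jW) mode_is_w_expectation scale0r addr0.
rewrite (fine_expectation_bool P (mode_is_measurable k c)).
by rewrite (mx_expectation_mulr _ iAO) (mx_expectation_mull _ iO).
Qed.

(** The probability [q] may vary with the time, so that the values 0 and 1 can account for a
    prescribed mode. *)
Lemma second_moment_step k q : P (mode k @^-1` [set true]) = q%:E ->
  second_moment P (Theta k.+1) =
  q *: (Abar true *m second_moment P (Theta k) *m (Abar true)^T) +
  (1 - q) *: (Abar false *m second_moment P (Theta k) *m (Abar false)^T) +
  sigma ^+ 2 *: (Bbar *m Bbar^T).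
Proof.
move=> Pq.
have [it Et] := branch_expectation k true.
have [if_ Ef] := branch_expectation k false.
have Lw2 : (fun t => w k t ^+ 2) \in Lfun P 1.
  exact/Lfun1_integrable/Lfun2_integrable_sqr/w_Lfun2.
have iw := mx_integrable_scale_cst (Bbar *m Bbar^T) Lw2.
rewrite {1}/second_moment; under eq_fun do rewrite outer_branch.
rewrite (mx_expectationD (mx_integrableD it if_) iw) (mx_expectationD it if_).
rewrite mx_expectation_scale_cst// w_sqr_expectation Et Ef.
have -> : mode_is k true @^-1` [set true] = mode k @^-1` [set true].
  by apply/seteqP; split => t /=; rewrite /mode_is eqb_id.
(* The event of mode [false] is the complement of that of mode [true], which produces the weight
   [1 - q]. *)
have -> : mode_is k false @^-1` [set true] = ~` (mode k @^-1` [set true]).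
  by apply/seteqP; split => t /=; rewrite /mode_is eqbF_neg; case: (mode k t).
rewrite probability_setC ?Pq//.
by rewrite -[X in measurable X]setTI; exact: mode_measurable.
Qed.

End SwitchedSystem.

(** * Limits of matrix sequences, entry by entry *)

Section EntrywiseConvergence.
Context {R : realType}.

Definition entrywise_cvg (m n : nat) (M : nat -> 'M[R]_(m, n))
    (L : 'M[R]_(m, n)) : Prop := forall i j, M k i j @[k --> \oo] --> L i j.

Lemma cvg_entrywise (m n : nat) (M : nat -> 'M[R]_(m, n)) (L : 'M[R]_(m, n)) :
  M k @[k --> \oo] --> L -> entrywise_cvg M L.
Proof.
move=> ML i j.
by apply: (cvg_comp M (fun A => A i j) ML); exact: coord_continuous.
Qed.

Lemma entrywise_cvg_unique (m n : nat) (M : nat -> 'M[R]_(m, n))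
    (L L' : 'M[R]_(m, n)) :
  entrywise_cvg M L -> entrywise_cvg M L' -> L = L'.
Proof.
move=> ML ML'; apply/matrixP => i j.
by have /cvg_lim <- // := ML i j; have /cvg_lim <- // := ML' i j.
Qed.

Lemma entrywise_cvgD (m n : nat) (M M' : nat -> 'M[R]_(m, n))
    (L L' : 'M[R]_(m, n)) :
  entrywise_cvg M L -> entrywise_cvg M' L' ->
  entrywise_cvg (fun k => M k + M' k) (L + L').
Proof.
by move=> ML ML' i j; rewrite mxE; under eq_fun do rewrite mxE; exact: cvgD.
Qed.

Lemma entrywise_cvg_cst (m n : nat) (C : 'M[R]_(m, n)) :
  entrywise_cvg (fun=> C) C.
Proof. by move=> i j; exact: cvg_cst. Qed.

Lemma entrywise_cvgM (m n q : nat) (M : nat -> 'M[R]_(m, n))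
    (M' : nat -> 'M[R]_(n, q)) (L : 'M[R]_(m, n)) (L' : 'M[R]_(n, q)) :
  entrywise_cvg M L -> entrywise_cvg M' L' ->
  entrywise_cvg (fun k => M k *m M' k) (L *m L').
Proof.
move=> ML ML' i j; rewrite mxE; under eq_fun do rewrite mxE.
by apply: cvg_big => [|l _]; [exact: add_continuous|exact: cvgM].
Qed.

Lemma entrywise_cvgZ (m n : nat) (c : R) (M : nat -> 'M[R]_(m, n))
    (L : 'M[R]_(m, n)) :
  entrywise_cvg M L -> entrywise_cvg (fun k => c *: M k) (c *: L).
Proof.
move=> ML i j; rewrite mxE; under eq_fun do rewrite mxE.
by apply: cvgM; [exact: cvg_cst|exact: ML].
Qed.

End EntrywiseConvergence.

(** This is the mean-variance decomposition of a matrix taking the values [A1] and [A0] with weights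
    [q] and [1 - q]; the scalar case is [q a^2 + (1-q) b^2 = (q a + (1-q) b)^2 + q (1-q)
    (a-b)^2]. *)
Lemma congruence_mean_deviation (R : comPzRingType) (n : nat) (q : R)
    (A1 A0 S : 'M[R]_n) :
  q *: (A1 *m S *m A1^T) + (1 - q) *: (A0 *m S *m A0^T) =
  (q *: A1 + (1 - q) *: A0) *m S *m (q *: A1 + (1 - q) *: A0)^T +
  (q * (1 - q)) *: ((A1 - A0) *m S *m (A1 - A0)^T).
Proof.
rewrite [(A1 - A0)^T]linearB [(q *: A1 + _)^T]linearD/= ![(_ *: _)^T]linearZ/=.
rewrite !(mulmxDl, mulmxDr, mulNmx, mulmxN) -!scalemxAl -!scalemxAr.
set X11 := A1 *m S *m A1^T; set X10 := A1 *m S *m A0^T.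
set X01 := A0 *m S *m A1^T; set X00 := A0 *m S *m A0^T.
apply/matrixP => i j; rewrite !mxE; ring.
Qed.

(** Mean square stability quantifies over processes with a prescribed initial mode; this recursion
    supplies such processes. *)
Fixpoint trajectory {T : Type} {R : pzRingType} {n : nat}
    (Abar : bool -> 'M[R]_n) (Bbar : 'cV[R]_n)
    (mode : nat -> T -> bool) (w : nat -> T -> R)
    (Theta0 : T -> 'cV[R]_n) (k : nat) (t : T) : 'cV[R]_n :=
  if k is l.+1 then
    Abar (mode l t) *m trajectory Abar Bbar mode w Theta0 l t + w l t *: Bbar
  else Theta0 t.

(** * From mean square stability to the fixed-point equation for the limit *)

Section Stability.
Context {dT : measure_display} {T : measurableType dT} {R : realType}.
Variable P : probability T R.
Variables (drop : nat -> {RV P >-> bool}) (w : nat -> {RV P >-> R}).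
Variables (n : nat) (Abar : bool -> 'M[R]_n) (Bbar : 'cV[R]_n).
Variables (Theta : nat -> T -> 'cV[R]_n) (pd sigma : R).
Hypothesis drop_prob : forall k, P (drop k @^-1` [set true]) = pd%:E.
Hypothesis w_mean : forall k, ('E_P[w k] = 0)%E.
Hypothesis w_var : forall k, ('V_P[w k] = (sigma ^+ 2)%:E)%E.
Hypothesis init : admissible_initial drop w (Theta 0%N).
Hypothesis dyn : ncs_dynamics Abar Bbar drop w Theta.

Let moment_map (S : 'M[R]_n) : 'M[R]_n :=
  pd *: (Abar true *m S *m (Abar true)^T) +
  (1 - pd) *: (Abar false *m S *m (Abar false)^T) +
  sigma ^+ 2 *: (Bbar *m Bbar^T).

(** It shares the initial state and all disturbances with [Theta]; only the mode at time 0 is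
    replaced by [d0]. *)
Let forced (d0 : bool) : nat -> T -> 'cV[R]_n :=
  trajectory Abar Bbar (set_initial_mode d0 drop) w (Theta 0%N).

Lemma drop_sigma k : sigma_rv (drop k) (drop k @^-1` [set true]).
Proof. by exists [set true] => //; rewrite setTI. Qed.

Lemma forced_sigma d0 k :
  sigma_rv (drop k) (set_initial_mode d0 drop k @^-1` [set true]).
Proof.
case: k => [|k]; last exact: drop_sigma.
case: d0; [exists setT|exists set0] => //; rewrite setTI.
  by apply/seteqP; split.
by apply/seteqP; split.
Qed.

Lemma forced_dynamics d0 :
  ncs_dynamics Abar Bbar (set_initial_mode d0 drop) w (forced d0).
Proof. by []. Qed.

Lemma second_moment_moment_map k :
  second_moment P (Theta k.+1) = moment_map (second_moment P (Theta k)).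
Proof.
by have := second_moment_step w_mean w_var init drop_sigma dyn (drop_prob k).
Qed.

(** The recursion starts at time 1, since at time 0 the mode is deterministic and has probability 0
    or 1 instead of [pd]. *)
Lemma forced_second_moment_moment_map d0 k :
  second_moment P (forced d0 k.+2) =
  moment_map (second_moment P (forced d0 k.+1)).
Proof.
have Pk : P (set_initial_mode d0 drop k.+1 @^-1` [set true]) = pd%:E.
  exact: drop_prob.
by have := second_moment_step w_mean w_var init (forced_sigma d0)
  (@forced_dynamics d0) Pk.
Qed.

Lemma forced_second_moment1 d0 :
  second_moment P (forced d0 1%N) =
  Abar d0 *m second_moment P (Theta 0%N) *m (Abar d0)^T +
  sigma ^+ 2 *: (Bbar *m Bbar^T).
Proof.
have P0 : P (set_initial_mode d0 drop 0%N @^-1` [set true]) = (d0%:R)%:E.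
  case: d0 => /=.
    by rewrite (_ : _ @^-1` _ = setT) ?probability_setT//; apply/seteqP; split.
  by rewrite (_ : _ @^-1` _ = set0) ?measure0//; apply/seteqP; split.
have := second_moment_step w_mean w_var init (forced_sigma d0)
  (@forced_dynamics d0) P0.
rewrite -/(forced d0) => ->; case: d0 {P0};
by rewrite /= ?subrr ?subr0 ?scale1r ?scale0r ?addr0 ?add0r.
Qed.

(** The first step produces the mixture, and [moment_map] preserves it because an affine map
    commutes with combinations whose weights sum to one. *)
Lemma second_moment_mixture k :
  second_moment P (Theta k.+1) =
  pd *: second_moment P (forced true k.+1) +
  (1 - pd) *: second_moment P (forced false k.+1).
Proof.
elim: k => [|k IH]; rewrite second_moment_moment_map.
  rewrite !forced_second_moment1 /moment_map !scalerDr addrACA; congr (_ + _).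
  by rewrite -scalerDl addrC subrK scale1r.
rewrite IH !forced_second_moment_moment_map /moment_map.
rewrite !mulmxDr !mulmxDl -!scalemxAr -!scalemxAl.
(* With the congruences and the disturbance term made opaque, the claim is a polynomial identity in
   their entries. *)
set M1 := second_moment P (forced true _).
set M0 := second_moment P (forced false _).
set X11 := Abar true *m M1 *m _; set X10 := Abar true *m M0 *m _.
set X01 := Abar false *m M1 *m _; set X00 := Abar false *m M0 *m _.
set BB := Bbar *m _; clearbody X11 X10 X01 X00 BB.
by apply/matrixP => i j; rewrite !mxE; ring.
Qed.

Lemma second_moment_cvg :
  mean_square_stable Abar Bbar drop w ->
  exists2 S, second_moment P (Theta k) @[k --> \oo] --> S & S = moment_map S.
Proof.
move=> [mu [S mss]].
have cvgS : second_moment P (Theta k) @[k --> \oo] --> S.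
  have [_ cvg1] := mss true (forced true) init (@forced_dynamics true).
  have [_ cvg0] := mss false (forced false) init (@forced_dynamics false).
  (* The mixture formula holds from time 1 on, so the limit is computed along the shifted
     sequence. *)
  rewrite -(cvg_shiftS (fun k => second_moment P (Theta k))).
  under eq_fun do rewrite second_moment_mixture.
  rewrite (_ : S = pd *: S + (1 - pd) *: S).
    by apply: cvgD; apply: cvgZ; try exact: cvg_cst;
      rewrite (cvg_shiftS (fun k => second_moment P (forced _ k))).
  by rewrite -scalerDl addrC subrK scale1r.
exists S => //.
(* The shifted sequence tends to [S], and being the image of the original one under [moment_map],
   also to [moment_map S] by continuity. *)
apply: (@entrywise_cvg_unique _ _ _ (fun k => second_moment P (Theta k.+1))).
  apply: cvg_entrywise.
  by rewrite (cvg_shiftS (fun k => second_moment P (Theta k))).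
under eq_fun do rewrite second_moment_moment_map.
have eS := cvg_entrywise cvgS.
apply: entrywise_cvgD; last exact: entrywise_cvg_cst.
by apply: entrywise_cvgD; apply: entrywise_cvgZ; apply: entrywise_cvgM;
  do ?[exact: entrywise_cvg_cst|apply: entrywise_cvgM].
Qed.

Lemma mx_expectation_mode k :
  mx_expectation P (fun t => Abar (drop k t)) =
  pd *: Abar true + (1 - pd) *: Abar false.
Proof.
have L1 : (fun t => (drop k t)%:R : R) \in Lfun P 1.
  apply: Lfun_subset12; first exact: fin_num_measure.
  have := Lfun2_mul_bool (measurable_funPT (drop k)) (Lfun_cst P 1 2).
  by under eq_fun do rewrite mulr1.
(* The random matrix is affine in the dropout indicator; the factor [1] makes the constant part a
   scaled constant variable, to which the same lemma applies. *)
rewrite (_ : (fun t => _) =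
    (fun t => (drop k t)%:R *: (Abar true - Abar false) + 1 *: Abar false)).
  have C1 : cst (1 : R) \in Lfun P 1 by exact: Lfun_cst.
  rewrite (mx_expectationD (mx_integrable_scale_cst _ L1)
    (mx_integrable_scale_cst _ C1)).
  rewrite (mx_expectation_scale_cst _ L1) (mx_expectation_scale_cst _ C1).
  rewrite fine_expectation_bool ?drop_prob// expectation_cst/=.
  by rewrite scalerBr scalerBl -addrA; congr (_ + _); rewrite addrC.
apply/funext => t; case: (drop k t); rewrite /= ?scale1r ?scale0r.
  by rewrite subrK.
by rewrite add0r.
Qed.

End Stability.

Theorem lemma1
  (R : realType) (p N : nat) (hN : (0 < N)%N)
  (A : 'M[R]_p) (B1 B2 : 'cV[R]_p)
  (hAB : controllable A B1 \/ stabilizable A B1)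
  (Q X : 'M[R]_p) (r : R)
  (hQ : psdmx Q) (hr : 0 < r) (hX : pdmx X) (hdare : dare A B1 Q r X)
  (dT : measure_display) (T : measurableType dT) (P : probability T R)
  (pd sigma : R)
  (drop : nat -> {RV P >-> bool}) (w : nat -> {RV P >-> R})
  (hdrop : forall k, P (drop k @^-1` [set true]) = pd%:E)
  (hw_gauss : forall k, gaussian (w k))
  (hw_mean : forall k, ('E_P[w k] = 0)%E)
  (hw_var : forall k, ('V_P[w k] = (sigma ^+ 2)%:E)%E)
  (x : nat -> T -> 'cV[R]_p)
  (* bprev k is b(k-1) *)
  (bprev : nat -> T -> 'cV[R]_N)
  (Theta : nat -> T -> 'cV[R]_(p + N))
  (hTheta : forall k t, Theta k t = col_mx (x k t) (bprev k t))
  (hinit : admissible_initial drop w (Theta 0%N))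
  (hdyn : ncs_dynamics (Abar_mx A B1 Q X r N) (Bbar_mx B2 N) drop w Theta)
  (hmss : mean_square_stable (Abar_mx A B1 Q X r N) (Bbar_mx B2 N) drop w)
  (hx_mean : mx_expectation P (x k) @[k --> \oo] --> (0 : 'cV[R]_p))
  (Qx : 'M[R]_p)
  (hQx_var : covariance_mx P (x k) @[k --> \oo] --> Qx)
  (hQx_mom : second_moment P (x k) @[k --> \oo] --> Qx) :
  let Abar := Abar_mx A B1 Q X r N in
  let Bbar := Bbar_mx B2 N in
  let Acal := pd *: Abar true + (1 - pd) *: Abar false in
  let Atil := Abar true - Abar false in
  let QTheta := lim (second_moment P (Theta k) @[k --> \oo]) in
  [/\ forall k, mx_expectation P (fun t => Abar (drop k t)) = Acal,
      second_moment P (Theta k) @[k --> \oo] --> QTheta &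
      QTheta = Acal *m QTheta *m Acal^T
               + (pd * (1 - pd)) *: (Atil *m QTheta *m Atil^T)
               + sigma ^+ 2 *: (Bbar *m Bbar^T)].
Proof.

move=> Abar Bbar Acal Atil QTheta.
have [S cvgS SE] :=
  second_moment_cvg hdrop hw_mean hw_var hinit hdyn hmss.
have QS : QTheta = S by apply: cvg_lim => //; exact: norm_hausdorff.
rewrite QS; split => //.
- by move=> k; exact: mx_expectation_mode.
(* Only the left-hand [S] is unfolded into its image under the moment recursion; the mean-deviation
   identity then gives the stated form. *)
- by rewrite {1}SE congruence_mean_deviation.
Qed.
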